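(* Let $S$ be a finite tree. Then $$\lim_{t_{\star} \to \infty} \lim_{n \to \infty} \mathrm{TV}\left( \mathrm{CUA}(n, t_{\star}, S), \mathrm{UA}(n, S)^{\otimes 2} \right) = 1.$$
   Context: Trees are regarded as unlabeled (up to isomorphism); $|S|$ is the number of vertices of $S$. Uniform attachment (UA) trees with seed tree $S$: $T_{|S|} = S$, and given $T_t$, the tree $T_{t+1}$ is obtained by adding one new vertex and one edge joining it to an existing vertex of $T_t$ chosen uniformly at random. $\mathrm{UA}(n,S)$ denotes the law of the $n$-vertex tree $T_n$. For $t_\star \ge |S|$ and $n \geq t_{\star}$, $\mathrm{CUA}(n, t_{\star}, S)$ is the law of the pair $(T_n^1, T_n^2)$, where $T_t^1 = T_t^2 =: T_t$ for $|S| \leq t \leq t_{\star}$ is grown from $S$ by UA, and conditionally on $T_{t_{\star}}$ the sequences $\{T_t^1\}_{t \geq t_{\star}}$, $\{T_t^2\}_{t \geq t_{\star}}$ are independent UA sequences started from $T_{t_{\star}}$. $\mathrm{UA}(n,S)^{\otimes 2}$ is the law of two independent samples of $\mathrm{UA}(n,S)$. $\mathrm{TV}(P,Q) = \sup_A |P(A) - Q(A)|$; the total variation distance above is non-increasing in $n$, so the inner limit exists. *)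

(* Defs.v *)
From HB Require Import structures.
From mathcomp Require Import all_boot all_order all_algebra.
From mathcomp Require Import generic_quotient.
From mathcomp Require Import all_classical all_reals all_analysis.

Set Implicit Arguments.
Unset Strict Implicit.
Unset Printing Implicit Defensive.

Import Order.TTheory GRing.Theory Num.Theory.
Import numFieldNormedType.Exports.

Local Open Scope classical_set_scope.
Local Open Scope ring_scope.

Section TreePredicates.
Variables (V : finType) (e : rel V).

Definition acyclic := forall c : seq V, (2 < size c)%N -> cycle e c -> ~~ uniq c.

Definition is_tree :=
  [/\ symmetric e, irreflexive e, (forall x y, connect e x y) & acyclic].

End TreePredicates.

(* A graph with n.+1 vertices is an adjacency table on 'I_n.+1, so that the
   vertex set is never empty. *)
Definition graph := {n : nat & {ffun 'I_n.+1 * 'I_n.+1 -> bool}}.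

Definition adj (G : graph) : rel 'I_(tag G).+1 := fun x y => tagged G (x, y).

Record tree := Tree { tree_graph : graph; _ : `[< is_tree (@adj tree_graph) >] }.

HB.instance Definition _ := [isSub for tree_graph].
HB.instance Definition _ := [Choice of tree by <:].

Definition tree_order (T : tree) : nat := (tag (tree_graph T)).+1.

Notation vertex T := ('I_(tag (tree_graph T)).+1).

Lemma treeP (T : tree) : is_tree (@adj (tree_graph T)).
Proof. by apply/asboolP; exact: (valP T). Qed.

Definition tree_iso : rel tree := fun T1 T2 =>
  `[< exists2 f : vertex T1 -> vertex T2,
        bijective f & forall x y, adj (f x) (f y) = adj x y >].

Lemma tree_iso_refl : reflexive tree_iso.
Proof. by move=> T; apply/asboolP; exists id => //; exists id. Qed.

Lemma tree_iso_sym : symmetric tree_iso.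
Proof.
suff H T1 T2 : tree_iso T1 T2 -> tree_iso T2 T1 by move=> T1 T2; apply/idP/idP; exact: H.
move=> /asboolP[f [g fK gK] fe]; apply/asboolP; exists g; first by exists f.
by move=> x y; rewrite -fe !gK.
Qed.

Lemma tree_iso_trans : transitive tree_iso.
Proof.
move=> T2 T1 T3 /asboolP[f bf fe] /asboolP[g bg ge]; apply/asboolP.
by exists (g \o f); [exact: bij_comp | move=> x y; rewrite /= ge fe].
Qed.

Canonical tree_iso_equiv :=
  EquivRel tree_iso tree_iso_refl tree_iso_sym tree_iso_trans.

Definition utree := {eq_quot tree_iso}%qT.

Definition unlabel (T : tree) : utree := (\pi_utree T)%qT.

Section Attach.
Variables (T : tree) (v : vertex T).

Definition attach_rel : rel 'I_(tag (tree_graph T)).+2 := fun x y =>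
  match unlift ord_max x, unlift ord_max y with
  | Some x', Some y' => adj x' y'
  | Some x', None => x' == v
  | None, Some y' => y' == v
  | None, None => false
  end.

Definition attach_graph : graph :=
  Tagged (fun n => {ffun 'I_n.+1 * 'I_n.+1 -> bool})
    [ffun p : 'I_(tag (tree_graph T)).+2 * 'I_(tag (tree_graph T)).+2 => attach_rel p.1 p.2].

Lemma attach_adjE (x y : 'I_(tag (tree_graph T)).+2) :
  adj (x : 'I_(tag attach_graph).+1) y = attach_rel x y.
Proof. by rewrite /adj ffunE. Qed.

Let old (x : vertex T) : 'I_(tag (tree_graph T)).+2 := lift ord_max x.

Lemma attach_rel_old (x y : vertex T) : attach_rel (old x) (old y) = adj x y.
Proof. by rewrite /attach_rel !liftK. Qed.

Lemma attach_rel_sym : symmetric attach_rel.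
Proof.
have [sT _ _ _] := treeP T; move=> x y; rewrite /attach_rel.
by case: (unlift _ x) (unlift _ y) => [x'|] [y'|].
Qed.

Lemma attach_rel_new x : attach_rel ord_max x -> x = old v.
Proof.
by rewrite /attach_rel unlift_none; case: unliftP => // j -> /eqP ->.
Qed.

Lemma attach_is_tree : is_tree (@adj attach_graph).
Proof.
have [sT iT cT aT] := treeP T.
have eqa : @adj attach_graph =2 attach_rel by move=> x y; exact: attach_adjE.
split.
- by move=> x y; rewrite !eqa attach_rel_sym.
- move=> x; rewrite eqa /attach_rel; case: unliftP => //= j _; exact: iT.
- have co x y : connect attach_rel (old x) (old y).
    have /connectP[p pth ->] := cT x y.
    elim: p x pth => [|z p IH] x //= /andP[xz pz].
    by apply: connect_trans (IH _ pz); apply: connect1; rewrite attach_rel_old.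
  have cv : connect attach_rel (old v) ord_max.
    by apply: connect1; rewrite /attach_rel liftK unlift_none.
  have cv' : connect attach_rel ord_max (old v).
    by apply: connect1; rewrite attach_rel_sym /attach_rel liftK unlift_none.
  move=> x y; rewrite (eq_connect eqa).
  have tov z : connect attach_rel z (old v).
    by case: (unliftP ord_max z) => [j ->|->].
  have ofv z : connect attach_rel (old v) z.
    by case: (unliftP ord_max z) => [j ->|->].
  exact: connect_trans (tov x) (ofv y).
- move=> c sc; rewrite (eq_cycle eqa) => cc; apply/negP => uc.
  have [mc|nmc] := boolP (ord_max \in c).
    have [i c' rc] := rot_to mc.
    have sc' : (2 < size (ord_max :: c'))%N by rewrite -rc size_rot.
    have uc' : uniq (ord_max :: c') by rewrite -rc rot_uniq.
    have : cycle attach_rel (ord_max :: c') by rewrite -rc rot_cycle.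
    case: c' sc' uc' {rc} => [|a c'] //.
    case/lastP: c' => [|c' b] // _.
    rewrite /= rcons_path last_rcons => /and3P[_ na _] /and3P[/attach_rel_new av _].
    rewrite attach_rel_sym => /attach_rel_new bv.
    by move: na; rewrite mem_rcons inE bv av eqxx.
  have [c' ec] : exists c', c = map old c'.
    elim: {sc cc uc} c nmc => [|x c IH]; first by exists [::].
    rewrite inE negb_or => /andP[xm /IH[c' ->]].
    by case: (unliftP ord_max x) xm => [j ->|-> /eqP//]; exists (j :: c').
  move: sc cc uc; rewrite ec size_map (map_inj_uniq lift_inj) => sc cc uc.
  have cc' : cycle (@adj (tree_graph T)) c'.
    case: (c') cc => //= a s.
    by rewrite -map_rcons path_map; apply: sub_path => x y /=; rewrite attach_rel_old.
  by move: (aT _ sc cc'); rewrite uc.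
Qed.

Definition attach : tree := Tree (asboolT attach_is_tree).

End Attach.

Definition single_graph : graph :=
  Tagged (fun n => {ffun 'I_n.+1 * 'I_n.+1 -> bool}) [ffun _ : 'I_1 * 'I_1 => false].

Lemma single_is_tree : is_tree (@adj single_graph).
Proof.
have a0 x y : @adj single_graph x y = false by rewrite /adj ffunE.
split.
- by move=> x y; rewrite !a0.
- by move=> x; rewrite a0.
- by move=> x y; rewrite (ord1 x) (ord1 y); exact: connect0.
- by case=> [|x [|y c]] //= _; rewrite a0.
Qed.

Definition single : tree := Tree (asboolT single_is_tree).

HB.instance Definition _ := Choice.on utree.
HB.instance Definition _ := isPointed.Build utree (unlabel single).
HB.instance Definition _ := @isMeasurable.Build default_measure_display utree
  discrete_measurable discrete_measurable0 discrete_measurableC discrete_measurableU.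

Lemma countable_utree : countable [set: utree].
Proof.
apply/countable_injP; exists (fun u => pickle (tree_graph (repr u))) => u1 u2 _ _.
move=> /(pcan_inj pickleK) /val_inj e.
by rewrite -[u1]reprK -[u2]reprK e.
Qed.

(* Every set of pairs is an event, so the supremum in [TV] below ranges over all of
   them. *)
Lemma measurable_utree2 (A : set (utree * utree)) : measurable A.
Proof.
apply: countable_measurable => [[x y]|].
  have -> : [set (x, y)] = [set x] `*` [set y].
    by apply/seteqP; split=> [[a b] [-> ->]|[a b] [/= -> ->]].
  exact: measurableX.
apply: (sub_countable _ (countableX countable_utree countable_utree)).
exact: subset_card_le.
Qed.

Section UniformMixture.
Context d (T : measurableType d) (R : realType) (n : nat).
Variable P : 'I_n.+1 -> probability T R.
Local Open Scope ereal_scope.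

Definition unif_mix (A : set T) : \bar R :=
  (n.+1%:R^-1)%:E * \sum_(i < n.+1) P i A.

Let unif_mix0 : unif_mix set0 = 0.
Proof. by rewrite /unif_mix big1 ?mule0. Qed.

Let unif_mix_ge0 A : 0 <= unif_mix A.
Proof. by rewrite mule_ge0 ?lee_fin ?invr_ge0 ?sume_ge0. Qed.

Let unif_mix_sigma_additive : semi_sigma_additive unif_mix.
Proof.
pose Q k : {measure set T -> \bar R} := P (inord k).
have c0 : (0 <= n.+1%:R^-1 :> R)%R by rewrite invr_ge0.
have -> : unif_mix = mscale (NngNum c0) (msum Q n.+1).
  apply/funext => A; rewrite /unif_mix /mscale /= /msum; congr (_ * _).
  by apply: eq_bigr => i _; rewrite /Q inord_val.
exact: measure_semi_sigma_additive.
Qed.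

HB.instance Definition _ := isMeasure.Build _ _ _ unif_mix
  unif_mix0 unif_mix_ge0 unif_mix_sigma_additive.

Let unif_mix_setT : unif_mix setT = 1.
Proof.
rewrite /unif_mix (eq_bigr (fun=> 1%:E)); last by move=> i _; rewrite probability_setT.
by rewrite sumEFin sumr_const card_ord -EFinM mulVf.
Qed.

HB.instance Definition _ := Measure_isProbability.Build _ _ _ unif_mix unif_mix_setT.

End UniformMixture.

(* If T_0 = T and T_k is obtained from T by k uniform attachment steps, then
   [ua_steps K k T] is the law of a variable which, given T_k, has law [K T_k]. *)
Fixpoint ua_steps d (X : measurableType d) (R : realType)
    (K : tree -> probability X R) (k : nat) (T : tree) : probability X R :=
  if k is k'.+1 then unif_mix (fun v : vertex T => ua_steps K k' (attach v))
  else K T.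

Section Laws.
Variable R : realType.

Definition UA (n : nat) (S : tree) : probability utree R :=
  ua_steps (fun T => \d_(unlabel T)) (n - tree_order S) S.

Definition UA2 (n : nat) (S : tree) : probability (utree * utree)%type R :=
  (UA n S \x UA n S)%E.

(* The stopped common tree T has tstar vertices, so [UA2 n T] runs two independent
   continuations of n - tstar steps each. The subtractions are truncated: these are
   the intended laws when tree_order S <= tstar <= n. *)
Definition CUA (n tstar : nat) (S : tree) : probability (utree * utree)%type R :=
  ua_steps (UA2 n) (tstar - tree_order S) S.

End Laws.

Definition TV d (X : measurableType d) (R : realType) (P Q : probability X R) : R :=
  sup [set `|fine (P A) - fine (Q A)| | A in measurable].

(* Main.v *)
Require Import Defs.
From mathcomp Require Import all_boot all_order all_algebra.
From mathcomp Require Import generic_quotient.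
From mathcomp Require Import all_classical all_reals all_analysis.
From mathcomp Require Import measurable_realfun.
From mathcomp Require Import lra zify ring.
Set Implicit Arguments.
Unset Strict Implicit.
Unset Printing Implicit Defensive.
Import Order.TTheory GRing.Theory Num.Theory.
Import numFieldNormedType.Exports.
Local Open Scope classical_set_scope.
Local Open Scope ring_scope.

(** Why the theorem holds.  Call a vertex set of a tree a cut if exactly one edge
    leaves it: cuts are the two sides of the edges.  Cut sizes are invariant under
    isomorphism.  While the tree grows, a cut gains the new vertex with
    probability (its size) / (order of the tree), so its size is a Polya urn, and
    its proportion of the vertices converges to a random limit with a continuous
    law.  Two trees sharing a long history therefore have cuts of almost the
    same proportion, namely the traces of an old common cut, while independent
    trees almost never do.  The two laws are separated by the event [near_cuts]
    that both trees have a balanced cut (proportion between 1/M and 1 - 1/M) and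
    that these two proportions differ by at most 1/D.

    Independent trees.  The expected number of cuts of size k in the tree of order
    n is at most a constant, depending on the seed, times
      n / (k (k+1)) + n / ((n-k) (n-k+1))
    ([iter_step_ncuts_le]); for a single vertex as seed this is an equality for
    0 < k < n.  Hence each balanced size occurs with probability O(1/n), and as
    there are O(n (n/D + 1)) pairs of close sizes, the event has probability
    O(1/D + 1/n), the implied constant depending on M and S
    ([UA2_near_cuts_le]).

    Correlated trees.  The first added vertex is a cut of size 1.  The urn started
    there spreads its mass: no value at time t has probability above
    |S| / (t - 1) ([iter_urn_step_spread]), so at time tstar its proportion lies
    between 2/M and 1 - 2/M except with probability O(|S| / M).  After tstar the
    variance of the proportion is at most 1/tstar ([iter_urn_step_variance]), so by
    Chebyshev both continuations keep it within 1/(2D) of its value at tstar,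
    except with probability O(D^2 / tstar) ([CUA_near_cuts_ge]).

    Choosing M, then D, then tstar, then n makes the distance close to 1.  The
    inner limit exists because one more growth step applies the same random
    map to both laws, which cannot increase their distance
    ([TV_CUA_UA2_nonincreasing]).

    All these laws are finite averages: [step] is the one-step averaging operator,
    and each probability above is an iterate of [step] applied to an indicator
    function, so no infinite random process has to be constructed. *)

(** * The one-step averaging operator *)

Section Step.
Variable R : realType.
Implicit Types (phi psi : tree -> R) (T : tree).

(** The backward (Markov semigroup) operator: [iter k step phi T] is the mean of
    [phi] over the tree grown from [T] by [k] attachments. *)
Definition step phi T : R :=
  (tree_order T)%:R^-1 * \sum_(v : vertex T) phi (attach v).

Lemma tree_order_gt0 T : 0 < (tree_order T)%:R :> R.
Proof. by rewrite ltr0n. Qed.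

Lemma tree_order_attach T (v : vertex T) : tree_order (attach v) = (tree_order T).+1.
Proof. by []. Qed.

Lemma le_iter_step k phi psi T :
  (forall T', tree_order T' = (tree_order T + k)%N -> phi T' <= psi T') ->
  iter k step phi T <= iter k step psi T.
Proof.
elim: k T => [|k IH] T h; first by apply: h; rewrite addn0.
rewrite !iterS /step ler_pM2l ?invr_gt0 ?tree_order_gt0 //.
by apply: ler_sum => v _; apply: IH => T' e; apply: h; rewrite e tree_order_attach addSnnS.
Qed.

Lemma eq_iter_step k phi psi T :
  (forall T', tree_order T' = (tree_order T + k)%N -> phi T' = psi T') ->
  iter k step phi T = iter k step psi T.
Proof. by move=> h; apply/le_anti/andP; split; apply: le_iter_step => T' e; rewrite h. Qed.

Lemma iter_step_cst k c T : iter k step (fun=> c) T = c.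
Proof.
elim: k T => [//|k IH] T; rewrite iterS /step (eq_bigr (fun=> c)); last by move=> v _; exact: IH.
by rewrite sumr_const card_ord -[c *+ _]mulr_natl mulKf // gt_eqF // tree_order_gt0.
Qed.

Lemma iter_step_scale k c phi T :
  iter k step (fun T => c * phi T) T = c * iter k step phi T.
Proof.
elim: k T => [//|k IH] T; rewrite !iterS /step mulrCA [c * _]mulr_sumr; congr (_ * _).
by apply: eq_bigr => v _; rewrite IH.
Qed.

Lemma iter_step_sum k (I : finType) (P : pred I) (phi : I -> tree -> R) T :
  iter k step (fun T => \sum_(i | P i) phi i T) T = \sum_(i | P i) iter k step (phi i) T.
Proof.
elim: k T => [//|k IH] T; rewrite iterS /step.
under eq_bigr do rewrite IH.
by rewrite exchange_big mulr_sumr.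
Qed.

Lemma iter_step_add k phi psi T :
  iter k step (fun T => phi T + psi T) T = iter k step phi T + iter k step psi T.
Proof.
elim: k T => [//|k IH] T; rewrite !iterS /step -mulrDr -big_split; congr (_ * _).
by apply: eq_bigr => v _; rewrite IH.
Qed.

End Step.

(** * The laws as iterated averages *)

Section LawsAsAverages.
Variable R : realType.
Local Notation dirac_law := (fun T : tree => \d_(unlabel T) : probability utree R).

Lemma ua_stepsE d (X : measurableType d) (K : tree -> probability X R) k T A :
  measurable A ->
  ua_steps K k T A = (iter k (@step R) (fun T' => fine (K T' A)) T)%:E.
Proof.
move=> mA; elim: k T => [|k IH] T; first by rewrite /= fineK ?fin_num_measure.
rewrite iterS /step EFinM -sumEFin /= /unif_mix; congr (_ * _)%E.
by apply: eq_bigr => v _; rewrite IH.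
Qed.

Lemma ge0_integral_unif_mix d (X : measurableType d) n (P : 'I_n.+1 -> probability X R)
    (f : X -> \bar R) : (forall x, 0 <= f x)%E -> measurable_fun setT f ->
  (\int[unif_mix P]_x f x = (n.+1%:R^-1)%:E * \sum_(i < n.+1) \int[P i]_x f x)%E.
Proof.
move=> f0 mf.
pose Q k : {measure set X -> \bar R} := P (inord k).
have c0 : 0 <= n.+1%:R^-1 :> R by rewrite invr_ge0.
rewrite (eq_measure_integral (mscale (NngNum c0) (msum Q n.+1))); last first.
  move=> A mA _; rewrite /= /unif_mix /mscale /= /msum; congr (_ * _)%E.
  by apply: eq_bigr => i _; rewrite /Q inord_val.
rewrite ge0_integral_mscale // ge0_integral_measure_sum //; congr (_ * _)%E.
by apply: eq_bigr => i _; rewrite /Q inord_val.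
Qed.

Lemma ge0_integral_UA (f : utree -> R) k T : (forall u, 0 <= f u) ->
  (\int[ua_steps dirac_law k T]_u (f u)%:E = (iter k (@step R) (f \o unlabel) T)%:E)%E.
Proof.
move=> f0; elim: k T => [|k IH] T.
  by rewrite integral_dirac //= diracT mul1e.
have f0' u : (0 <= (f u)%:E)%E by rewrite lee_fin.
rewrite /= ge0_integral_unif_mix //.
rewrite -/(iter k.+1 _ _) /= /step EFinM -sumEFin; congr (_ * _)%E.
by apply: eq_bigr => v _; rewrite IH.
Qed.

Lemma UA_E n T A : UA R n T A =
  (iter (n - tree_order T) (@step R) (fun T' => \1_A (unlabel T')) T)%:E.
Proof. by rewrite /UA ua_stepsE. Qed.

(** The definition of the product measure as an integral of sections turns
    independence into two nested averages. *)
Lemma UA2_E n T A : UA2 R n T A =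
  (iter (n - tree_order T) (@step R) (fun T1 =>
     iter (n - tree_order T) (@step R) (fun T2 =>
       \1_A (unlabel T1, unlabel T2)) T) T)%:E.
Proof.
rewrite /UA2 /product_measure1 /= /product_measure1.
transitivity (\int[UA R n T]_u (fine (UA R n T (xsection A u)))%:E)%E.
  by apply: eq_integral => u _; rewrite fineK // fin_num_measure.
rewrite ge0_integral_UA; last by move=> u; rewrite fine_ge0.
congr (_%:E); apply: eq_iter_step => T1 _ /=; rewrite UA_E /=.
apply: eq_iter_step => T2 _; rewrite !indicE; congr (_%:R).
by rewrite mem_xsection.
Qed.

Lemma CUA_E n tstar T A : CUA R n tstar T A =
  (iter (tstar - tree_order T) (@step R) (fun T' => fine (UA2 R n T' A)) T)%:E.
Proof. by rewrite /CUA ua_stepsE //; exact: measurable_utree2. Qed.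

End LawsAsAverages.

(** * Monotonicity of the distance in n *)

Section Growth.
Variable R : realType.

Lemma tree_iso_order T1 T2 : tree_iso T1 T2 -> tree_order T1 = tree_order T2.
Proof.
by move=> /asboolP[f /bij_eq_card]; rewrite !card_ord.
Qed.

Lemma unlabelE T1 T2 : unlabel T1 = unlabel T2 <-> tree_iso T1 T2.
Proof. by split=> [/eqmodP//|h]; apply/eqmodP. Qed.

Lemma attach_iso T1 T2 (f : vertex T1 -> vertex T2) (v : vertex T1) : bijective f ->
  (forall x y, adj (f x) (f y) = adj x y) ->
  tree_iso (attach v) (attach (f v)).
Proof.
move=> [g fK gK] fe; apply/asboolP.
pose F n m (h : 'I_n.+1 -> 'I_m.+1) (x : 'I_n.+2) : 'I_m.+2 :=
  if unlift ord_max x is Some y then lift ord_max (h y) else ord_max.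
have FK n m (h : 'I_n.+1 -> 'I_m.+1) h' : cancel h h' -> cancel (F n m h) (F m n h').
  move=> hK x; rewrite /F; case: (unliftP ord_max x) => [y ->|->].
    by rewrite liftK hK.
  by rewrite unlift_none.
exists (F _ _ f); first by exists (F _ _ g); exact: FK.
move=> x y; rewrite !attach_adjE /attach_rel /F.
have fI := can_inj fK.
by case: (unliftP ord_max x) => [x' _|_]; case: (unliftP ord_max y) => [y' _|_];
  rewrite ?liftK ?unlift_none ?fe ?(inj_eq fI).
Qed.

(** One growth step of an unlabelled tree, driven by an index: for an independent
    uniform index [i], [grow i] realises the attachment step.  This reduces a
    growth step to an average of deterministic maps that do not depend on the law
    they are applied to. *)
Definition grow (i : nat) (u : utree) : utree :=
  unlabel (attach (inord i : vertex (repr u))).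

(** Reindexing along an isomorphism makes the choice of representative in [grow]
    harmless once all vertices are averaged over. *)
Lemma step_unlabel (phi : utree -> R) T :
  step (phi \o unlabel) T =
  (tree_order T)%:R^-1 * \sum_(i < tree_order T) phi (grow i (unlabel T)).
Proof.
rewrite /step; congr (_ * _).
have /asboolP[f bf fe] : tree_iso T (repr (unlabel T)).
  by apply/unlabelE; rewrite /unlabel reprK.
have eo : tree_order (repr (unlabel T)) = tree_order T.
  by apply/esym/tree_iso_order/asboolP; exists f.
transitivity (\sum_(w : vertex (repr (unlabel T))) phi (unlabel (attach w))).
  rewrite [RHS](reindex f) /=; last exact: onW_bij.
  apply: eq_bigr => v _; congr phi; apply/unlabelE; exact: attach_iso.
pose G (w : vertex (repr (unlabel T))) := phi (unlabel (attach w)).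
rewrite -[LHS]/(\sum_w G w) -[RHS]/(\sum_(i < tree_order T) G (inord i)).
move: eo G; rewrite /tree_order => -[->] G.
by apply: eq_bigr => i _; rewrite inord_val.
Qed.

Definition grow2 (i j : nat) (p : utree * utree) := (grow i p.1, grow j p.2).

Lemma UA2_growE n T A : (tree_order T <= n)%N ->
  fine (UA2 R n.+1 T A) =
  n%:R^-2 * \sum_(ij : 'I_n * 'I_n) fine (UA2 R n T (grow2 ij.1 ij.2 @^-1` A)).
Proof.
move=> Tn; rewrite UA2_E /= subSn // iterSr.
set k := (n - _)%N.
transitivity (iter k (@step R) (fun T1 => n%:R^-1 * \sum_(i < n)
    iter k (@step R) (fun T2 => n%:R^-1 * \sum_(j < n)
      \1_A (grow i (unlabel T1), grow j (unlabel T2))) T) T).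
  apply: eq_iter_step => T1 e1.
  have e1' : tree_order T1 = n by rewrite e1 subnKC.
  rewrite -e1' -(step_unlabel (fun u => iter k (@step R) (fun T2 =>
    (tree_order T1)%:R^-1 * \sum_(j < tree_order T1)
      \1_A (u, grow j (unlabel T2))) T)).
  rewrite /step; congr (_ * _); apply: eq_bigr => v _; rewrite iterSr.
  apply: eq_iter_step => T2 e2.
  have -> : tree_order T1 = tree_order T2 by rewrite e1 e2.
  exact: (step_unlabel (fun u => \1_A (unlabel (attach v), u))).
rewrite iter_step_scale iter_step_sum -[n%:R ^- 2]/((n%:R * n%:R)^-1) invfM -mulrA; congr (_ * _).
rewrite -(pair_bigA _ (fun i j : 'I_n => fine (UA2 R n T (grow2 i j @^-1` A)))) /=.
rewrite mulr_sumr; apply: eq_bigr => i _.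
transitivity (iter k (@step R) (fun T1 => n%:R^-1 * \sum_(j < n)
    iter k (@step R) (fun T2 => \1_A (grow i (unlabel T1), grow j (unlabel T2))) T) T).
  by apply: eq_iter_step => T1 _; rewrite iter_step_scale iter_step_sum.
rewrite iter_step_scale iter_step_sum; congr (_ * _); apply: eq_bigr => j _.
rewrite UA2_E /= -/k; do 2!apply: eq_iter_step => ? _.
by rewrite !indicE; congr (_%:R); apply/idP/idP; rewrite !inE.
Qed.

(** The common growth up to [tstar] averages [UA2], so it inherits the identity
    [UA2_growE] with the same maps; that both laws use the same maps is what
    lets their distance be compared at times n and n + 1. *)
Lemma CUA_growE n tstar S A : (tree_order S <= tstar)%N -> (tstar <= n)%N ->
  fine (CUA R n.+1 tstar S A) =
  n%:R^-2 * \sum_(ij : 'I_n * 'I_n) fine (CUA R n tstar S (grow2 ij.1 ij.2 @^-1` A)).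
Proof.
move=> St tn; rewrite CUA_E /=.
under eq_bigr do rewrite CUA_E /=.
rewrite -iter_step_sum -iter_step_scale; apply: eq_iter_step => T e.
by apply: UA2_growE; rewrite e subnKC.
Qed.

Lemma dist_probability_le1 d (X : measurableType d) (P Q : probability X R) A :
  measurable A -> `|fine (P A) - fine (Q A)| <= 1.
Proof.
move=> mA.
have pB (P' : probability X R) : 0 <= fine (P' A) <= 1.
  rewrite fine_ge0 //= -lee_fin fineK ?fin_num_measure //; exact: probability_le1.
have /andP[p0 p1] := pB P; have /andP[q0 q1] := pB Q.
rewrite ler_norml; lra.
Qed.

Lemma le_TV d (X : measurableType d) (P Q : probability X R) A : measurable A ->
  `|fine (P A) - fine (Q A)| <= TV P Q.
Proof.
move=> mA; apply: ub_le_sup; last by exists A.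
by exists 1 => _ [B mB <-]; exact: dist_probability_le1.
Qed.

Lemma TV_le d (X : measurableType d) (P Q : probability X R) (c : R) :
  (forall A, measurable A -> `|fine (P A) - fine (Q A)| <= c) -> TV P Q <= c.
Proof.
move=> h; apply: ge_sup => [|_ [A mA <-]]; last exact: h.
by exists `|fine (P set0) - fine (Q set0)|, set0.
Qed.

Lemma TV_ge0 d (X : measurableType d) (P Q : probability X R) : 0 <= TV P Q.
Proof. exact: le_trans (normr_ge0 _) (le_TV P Q measurable0). Qed.

Lemma TV_le1 d (X : measurableType d) (P Q : probability X R) : TV P Q <= 1.
Proof. by apply: TV_le => A; exact: dist_probability_le1. Qed.

(** Data processing: the probabilities of an event at time n + 1 are averages of the
    probabilities, at time n, of its preimages under [grow2]. *)
Lemma TV_CUA_UA2_nonincreasing n tstar S : (tree_order S <= tstar)%N -> (tstar <= n)%N ->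
  TV (CUA R n.+1 tstar S) (UA2 R n.+1 S) <= TV (CUA R n tstar S) (UA2 R n S).
Proof.
move=> St tn; apply: TV_le => A _.
have n0 : (0 < n)%N by apply: leq_trans tn; apply: leq_trans St.
rewrite CUA_growE // UA2_growE ?(leq_trans St) // -mulrBr -sumrB normrM.
rewrite ger0_norm ?invr_ge0 ?exprn_ge0 // mulrC ler_pdivrMr ?exprn_gt0 ?ltr0n //.
apply: (le_trans (ler_norm_sum _ _ _)).
apply: (@le_trans _ _ (\sum_(ij : 'I_n * 'I_n) TV (CUA R n tstar S) (UA2 R n S))).
  by apply: ler_sum => ij _; apply: le_TV; exact: measurable_utree2.
by rewrite sumr_const card_prod !card_ord -[_ *+ (n * n)]mulr_natr natrM expr2.
Qed.

Lemma is_cvg_TV_CUA_UA2 tstar S : (tree_order S <= tstar)%N ->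
  cvg (TV (CUA R n tstar S) (UA2 R n S) @[n --> \oo]).
Proof.
move=> St; apply: (@near_nonincreasing_is_cvgn _ _ 0); last first.
  by apply: nearW => n; exact: TV_ge0.
exists tstar => // n /= tn m nm; rewrite -(subnKC nm).
elim: (m - n)%N => [|j IH]; first by rewrite addn0.
apply: le_trans IH; rewrite addnS; apply: TV_CUA_UA2_nonincreasing => //.
exact: leq_trans (leq_addr _ _).
Qed.

End Growth.

(** * Cuts and their evolution *)

Section Cuts.
Implicit Types (T : tree).

Definition crossings T (A : {set vertex T}) : nat :=
  (\sum_(x : vertex T) \sum_(y : vertex T) [&& x \in A, y \notin A & adj x y])%N.

(** Counting the edges that leave [A] avoids deleting an edge and taking the component of
    an endpoint; by connectedness the sets with exactly one outgoing edge are the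
    same objects. *)
Definition is_cut T (A : {set vertex T}) : bool := crossings A == 1%N.

Definition cuts T (k : nat) : {set {set vertex T}} :=
  [set A | is_cut A & #|A| == k]%SET.

(** Every vertex set of the grown tree arises exactly once in this way; the boolean
    tells whether the new vertex belongs to it. *)
Definition extend n (b : bool) (A : {set 'I_n.+1}) : {set 'I_n.+2} :=
  [set x | if unlift ord_max x is Some y then y \in A else b]%SET.

Lemma in_extend_lift n b (A : {set 'I_n.+1}) y : (lift ord_max y \in extend b A) = (y \in A).
Proof. by rewrite inE liftK. Qed.

Lemma in_extend_max n b (A : {set 'I_n.+1}) : (ord_max \in extend b A) = b.
Proof. by rewrite inE unlift_none. Qed.

Lemma card_extend n b (A : {set 'I_n.+1}) : #|extend b A| = (#|A| + b)%N.
Proof.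
rewrite -!sum1_card big_mkcond (bigD1_ord ord_max) //= in_extend_max addnC.
congr (_ + _)%N.
by rewrite [RHS]big_mkcond; apply: eq_bigr => y _; rewrite in_extend_lift.
Qed.

Lemma extend_bij n :
  bijective (fun p : bool * {set 'I_n.+1} => extend p.1 p.2).
Proof.
exists (fun B : {set 'I_n.+2} => (ord_max \in B, [set y | lift ord_max y \in B]%SET)).
  move=> [b A]; rewrite in_extend_max; congr (_, _).
  by apply/setP => y; rewrite inE in_extend_lift.
move=> B; apply/setP => x; case: (unliftP ord_max x) => [y ->|->].
  by rewrite in_extend_lift inE.
by rewrite in_extend_max.
Qed.

(** The only new edge joins the new vertex to [v], and it is crossed exactly when the
    two lie on different sides. *)
Lemma crossings_extend T (v : vertex T) b (A : {set vertex T}) :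
  crossings (extend b A : {set vertex (attach v)}) = (crossings A + (b != (v \in A)))%N.
Proof.
have sum_v (P : pred (vertex T)) : (\sum_(y : vertex T) (P y && (y == v)) = P v :> nat)%N.
  rewrite (bigD1 v) //= eqxx andbT big1 ?addn0 // => y /negPf ->.
  by rewrite andbF.
rewrite /crossings (bigD1_ord ord_max) //= (bigD1_ord ord_max) //=.
rewrite attach_adjE {1}/attach_rel unlift_none !andbF add0n.
under eq_bigr => y _.
  rewrite in_extend_max in_extend_lift attach_adjE /attach_rel unlift_none liftK andbA.
  over.
rewrite (sum_v (fun y => b && (y \notin A))).
under [X in (_ + X)%N]eq_bigr => x _.
  rewrite (bigD1_ord ord_max) //= in_extend_lift in_extend_max attach_adjE {1}/attach_rel.
  rewrite liftK unlift_none andbA.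
  under eq_bigr do rewrite !in_extend_lift attach_adjE attach_rel_old.
  over.
rewrite big_split /= (sum_v (fun x => (x \in A) && ~~ b)) addnA addnC; congr (_ + _)%N.
by case: b; case: (v \in A).
Qed.

Lemma crossings_set0 T : crossings (finset.set0 : {set vertex T}) = 0%N.
Proof. by rewrite /crossings big1 // => x _; rewrite big1 // => y _; rewrite !inE. Qed.

Lemma crossings_setT T : crossings (finset.setT : {set vertex T}) = 0%N.
Proof. by rewrite /crossings big1 // => x _; rewrite big1 // => y _; rewrite !inE. Qed.

Lemma crossings_eq0 T (A : {set vertex T}) : crossings A = 0%N ->
  A = finset.set0 \/ A = finset.setT.
Proof.
move=> /eqP; rewrite /crossings sum_nat_eq0 => /forallP h.
have h1 x y : adj x y -> x \in A -> y \in A.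
  move=> xy xA; have := h x; rewrite sum_nat_eq0 => /forallP/(_ y) /=.
  by rewrite xA xy andbT eqb0 negbK.
have [sT _ cT _] := treeP T.
have cA x y : (x \in A) = (y \in A).
  exact: (closed_connect (intro_closed (sym_connect_sym sT) h1) (cT x y)).
have [in0|in0] := boolP (ord0 \in A); [right|left]; apply/setP => x.
  by rewrite inE -(cA ord0) in0.
by rewrite inE -(cA ord0) (negPf in0).
Qed.

Lemma is_cut_bounds T (A : {set vertex T}) : is_cut A -> (0 < #|A| < tree_order T)%N.
Proof.
move=> cA; apply/andP; split.
  by rewrite card_gt0; apply: contraTN cA => /eqP ->; rewrite /is_cut crossings_set0.
rewrite -[tree_order T]card_ord -cardsT proper_card // properT.
by apply: contraTN cA => /eqP ->; rewrite /is_cut crossings_setT.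
Qed.

(** Cuts persist: this is the trace of an old cut in the grown tree, which follows the
    Polya urn. *)
Lemma is_cut_extend T (v : vertex T) (A : {set vertex T}) : is_cut A ->
  is_cut (extend (v \in A) A : {set vertex (attach v)}).
Proof. by rewrite /is_cut crossings_extend eqxx addn0. Qed.

Lemma is_cut_new T (v : vertex T) :
  is_cut (extend true finset.set0 : {set vertex (attach v)}).
Proof. by rewrite /is_cut crossings_extend crossings_set0 ?inE. Qed.

Lemma card_cutsE T k :
  #|cuts T k| = (\sum_(A : {set vertex T}) (is_cut A && (#|A| == k)))%N.
Proof. by rewrite -sum1_card big_mkcond; apply: eq_bigr => A _; rewrite inE; case: ifP. Qed.

(** A cut of the grown tree either restricts to a cut, and then the new vertex is on the
    side of its neighbour, or restricts to a set without outgoing edge, hence to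
    the empty or the full set, and then it is the new vertex alone or its
    complement. *)
Lemma card_cuts_attach T (v : vertex T) k :
  (#|cuts (attach v) k| <=
   \sum_(A : {set vertex T}) (is_cut A && (#|A| + (v \in A) == k)) +
   ((k == 1) + (k == tree_order T)))%N.
Proof.
rewrite card_cutsE (reindex (fun p : bool * {set vertex T} => extend p.1 p.2)) /=; last first.
  by apply: onW_bij; exact: extend_bij.
rewrite -(pair_bigA _ (fun b (A : {set vertex T}) =>
  nat_of_bool (is_cut (extend b A : {set vertex (attach v)}) && (#|extend b A| == k)))) /=.
apply: (@leq_trans (\sum_(b : bool) (\sum_(A : {set vertex T})
    ((b == (v \in A)) && (is_cut A && (#|A| + (v \in A) == k))) +
    (if b then k == 1 else k == tree_order T))))%N.
  apply: leq_sum => b _.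
  (* Given b, the only set with no outgoing edge to which a cut can restrict. *)
  pose A0 : {set vertex T} := if b then finset.set0 else finset.setT.
  apply: (@leq_trans (\sum_(A : {set vertex T})
    (((b == (v \in A)) && (is_cut A && (#|A| + (v \in A) == k))) +
     (if A == A0 then (if b then k == 1 else k == tree_order T) : nat else 0))))%N; last first.
    by rewrite big_split /= leq_add2l -big_mkcond big_pred1_eq.
  apply: leq_sum => A _; rewrite card_extend /is_cut crossings_extend.
  case: (eqVneq b (v \in A)) => [->|bA] /=.
    by rewrite addn0 leq_addr.
  rewrite addn1 eqSS add0n.
  case: (eqVneq (crossings A) 0%N) => [/crossings_eq0[] eA|//] /=; move: bA; rewrite /A0 eA inE.
    by case: b {A0} => // _; rewrite eqxx cards0 eq_sym.
  case: b {A0} => // _; rewrite eqxx cardsT card_ord addn0 eq_sym.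
  by rewrite /tree_order.
rewrite big_split /= leq_add //; last by rewrite big_bool.
rewrite exchange_big leq_sum // => A _.
by rewrite big_bool; case: (v \in A); rewrite /= ?addn0.
Qed.

Lemma sum_card_cuts_attach T k : (0 < k)%N ->
  (\sum_(v : vertex T) #|cuts (attach v) k| <=
   (tree_order T - k) * #|cuts T k| + k.-1 * #|cuts T k.-1| +
   tree_order T * ((k == 1) + (k == tree_order T)))%N.
Proof.
move=> k0.
apply: leq_trans; first by apply: leq_sum => v _; exact: card_cuts_attach.
rewrite big_split /= sum_nat_const card_ord leq_add2r exchange_big /=.
rewrite !card_cutsE !big_distrr /= -big_split /= leq_sum // => A _.
case: (is_cut A); last by rewrite big1.
rewrite /= (bigID (mem A)) /=.
rewrite (eq_bigr (fun=> nat_of_bool (#|A|.+1 == k))); last by move=> v ->; rewrite addn1.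
rewrite [X in (_ + X)%N](eq_bigr (fun=> nat_of_bool (#|A| == k))); last first.
  by move=> v /negPf ->; rewrite addn0.
rewrite !sum_nat_const.
have -> : #|[pred i : vertex T | i \notin A]| = (tree_order T - #|A|)%N.
  by rewrite -[tree_order T]card_ord -(cardC A) addKn.
case: k k0 => // k _ /=; rewrite eqSS addnC.
move: #|A| => a; apply: leq_add.
  by case: eqP => [->|_]; rewrite ?muln0.
by case: eqP => [->|_]; rewrite ?muln0.
Qed.

Definition has_cut T k := [exists A : {set vertex T}, is_cut A && (#|A| == k)].

Lemma has_cut_card T k : has_cut T k = (0 < #|cuts T k|)%N.
Proof.
apply/existsP/card_gt0P => -[A hA]; exists A; first by rewrite inE.
by rewrite inE in hA.
Qed.

Lemma tree_iso_has_cut T1 T2 k : tree_iso T1 T2 -> has_cut T1 k -> has_cut T2 k.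
Proof.
move=> /asboolP[f bf fe] /existsP[A /andP[cA /eqP <-]].
have fI := bij_inj bf.
apply/existsP; exists (f @: A)%SET; rewrite card_imset // eqxx andbT.
move: cA; rewrite /is_cut => /eqP <-; rewrite /crossings (reindex f) /=; last exact: onW_bij.
apply/eqP/eq_bigr => x _; rewrite (reindex f) /=; last exact: onW_bij.
by apply: eq_bigr => y _; rewrite !mem_imset // fe.
Qed.

Lemma has_cut_repr T k : has_cut (repr (unlabel T)) k = has_cut T k.
Proof.
have i : tree_iso T (repr (unlabel T)) by apply/unlabelE; rewrite /unlabel reprK.
by apply/idP/idP; apply: tree_iso_has_cut; rewrite // tree_iso_sym.
Qed.

End Cuts.

(** * Expected number of cuts of a given size *)

Section CutCounts.
Variable R : realType.
Implicit Types (T S : tree).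

Definition ncuts k T : R := #|cuts T k|%:R.

(** The mean number of vertices having a subtree of size [k < n] in the random
    recursive tree of order [n]. *)
Definition fringe (n k : nat) : R := n%:R / (k * k.+1)%:R.

(** Each edge has two sides, of sizes [k] and [n - k]; hence the symmetrization. *)
Definition profile (n k : nat) : R := fringe n k + fringe n (n - k).

Lemma fringe_rec n k : (0 < k <= n)%N ->
  (n - k)%:R / n%:R * fringe n k + k.-1%:R / n%:R * fringe n k.-1 + (k == 1%N)%:R =
  fringe n.+1 k.
Proof.
case: k => // k /andP[_ kn]; rewrite /fringe /= eqSS natrB // !natrM -!natr1.
have n0 : n%:R != 0 :> R by rewrite pnatr_eq0; lia.
have p0 (i : nat) : i%:R + 1 != 0 :> R by rewrite natr1 pnatr_eq0.
have p1 (i : nat) : i%:R + 1 + 1 != 0 :> R by rewrite !natr1 pnatr_eq0.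
case: k kn => [|k] kn /=.
  by rewrite mulr0n !mul0r !addr0 !add0r; field.
by rewrite -natr1; field; rewrite n0 p0 p1 natr1 p1.
Qed.

(** The complementary term solves the recursion of [fringe] at [n + 1 - k], with its two
    coefficients exchanged. *)
Lemma profile_rec n k : (0 < k <= n)%N ->
  (n - k)%:R / n%:R * profile n k + k.-1%:R / n%:R * profile n k.-1 +
    ((k == 1) + (k == n))%N%:R = profile n.+1 k.
Proof.
move=> /andP[k0 kn]; rewrite /profile -(@fringe_rec n k) ?k0 //.
rewrite -(@fringe_rec n (n.+1 - k)); last by lia.
have -> : (n - (n.+1 - k) = k.-1)%N by lia.
have -> : ((n.+1 - k).-1 = n - k)%N by lia.
have -> : (n - k.-1 = n.+1 - k)%N by lia.
have -> : (n.+1 - k == 1)%N = (k == n)%N by apply/eqP/eqP; lia.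
rewrite natrD; ring.
Qed.

Lemma step_ncuts_le k T : (0 < k)%N ->
  step (ncuts k) T <= (tree_order T - k)%:R / (tree_order T)%:R * ncuts k T +
    k.-1%:R / (tree_order T)%:R * ncuts k.-1 T + ((k == 1) + (k == tree_order T))%N%:R.
Proof.
move=> k0; rewrite /step /ncuts -natr_sum.
have n0 := tree_order_gt0 R T.
rewrite mulrC ler_pdivrMr // !mulrDl -!mulrA.
have e (x : R) : (tree_order T)%:R^-1 * (x * (tree_order T)%:R) = x.
  by rewrite mulrC mulfK ?gt_eqF.
rewrite !e -!natrM -!natrD ler_nat (mulnC (_ + _)%N); exact: sum_card_cuts_attach.
Qed.

(** A crude constant dominating the cut counts of the seed: there are at most
    [2 ^ t] vertex sets, and [profile t k] is at least [1 / t] for [0 < k < t]. *)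
Definition seed_bound T : R := (2 ^ tree_order T * tree_order T)%:R.

(** The expected counts satisfy, as inequalities, the linear recursion solved exactly by
    [profile]; the coefficients are nonnegative, so a multiple of [profile]
    dominating them initially, and large enough for the source terms, dominates
    them forever. *)
Lemma iter_step_ncuts_le j k T : (0 < k < tree_order T + j)%N ->
  iter j (@step R) (ncuts k) T <= seed_bound T * profile (tree_order T + j) k.
Proof.
set t := tree_order T.
have C0 : 0 <= seed_bound T by [].
have fr0 n i : 0 <= fringe n i by rewrite divr_ge0.
elim: j k => [|j IH] k /andP[k0].
  rewrite addn0 /= => kt.
  apply: (@le_trans _ _ (2 ^ t)%:R).
    rewrite /ncuts ler_nat; apply: leq_trans (max_card _) _.
    by rewrite -cardsT -powersetT card_powerset cardsT card_ord.
  apply: (@le_trans _ _ (seed_bound T * fringe t k)); last first.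
    by rewrite ler_wpM2l // lerDl.
  rewrite /fringe mulrA ler_pdivlMr ?ltr0n ?muln_gt0 ?k0 //.
  rewrite -!natrM ler_nat -mulnA leq_mul2l; apply/orP; right.
  by apply: leq_mul => //; apply: ltnW.
rewrite addnS ltnS => kn; rewrite iterSr; set n := (t + j)%N.
apply: (@le_trans _ _ (iter j (@step R) (fun T' => (n - k)%:R / n%:R * ncuts k T' +
    k.-1%:R / n%:R * ncuts k.-1 T' + ((k == 1) + (k == n))%N%:R) T)).
  by apply: le_iter_step => T' e; apply: le_trans (step_ncuts_le _ k0) _; rewrite e.
rewrite !iter_step_add !iter_step_scale iter_step_cst.
have w0 (i : nat) : 0 <= i%:R / n%:R :> R by rewrite divr_ge0.
have h1 : (n - k)%:R / n%:R * iter j (@step R) (ncuts k) T <=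
    (n - k)%:R / n%:R * (seed_bound T * profile n k).
  have [kn'|nk] := ltnP k n; first by rewrite ler_wpM2l ?w0 ?IH ?k0.
  by have -> : (n - k = 0)%N by [lia]; rewrite !mul0r.
have h2 : k.-1%:R / n%:R * iter j (@step R) (ncuts k.-1) T <=
    k.-1%:R / n%:R * (seed_bound T * profile n k.-1).
  have [k1|] := ltnP 1 k; first by rewrite ler_wpM2l ?w0 ?IH //; lia.
  by case: (k) => [|[|]] //; rewrite !mul0r.
have h3 : ((k == 1) + (k == n))%N%:R <= seed_bound T * ((k == 1) + (k == n))%N%:R.
  by rewrite ler_peMl // ler1n muln_gt0 expn_gt0.
apply: le_trans (lerD (lerD h1 h2) h3) _.
by rewrite -profile_rec ?k0 // le_eqVlt; apply/orP; left; apply/eqP; ring.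
Qed.

Definition window (M n k : nat) := (n <= M * k)%N && (n <= M * (n - k))%N.

(** The event that separates the two laws.  It is phrased over the natural numbers; of
    the two truncated differences one is always zero. *)
Definition near_cuts (M D n : nat) : set (utree * utree) :=
  [set p | exists k1 k2, [/\ window M n k1 && window M n k2,
     (D * (k1 - k2) <= n)%N && (D * (k2 - k1) <= n)%N &
     has_cut (repr p.1) k1 && has_cut (repr p.2) k2]].

Lemma profile_window_le M n k : (0 < n)%N -> window M n k ->
  profile n k <= 2 * (M ^ 2)%:R / n%:R.
Proof.
move=> n0 /andP[wk wnk].
have h i : (n <= M * i)%N -> fringe n i <= (M ^ 2)%:R / n%:R.
  case: i => [|i] wi; first by lia.
  rewrite /fringe ler_pdivrMr ?ltr0n // mulrAC ler_pdivlMr ?ltr0n //.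
  rewrite -!natrM ler_nat; nia.
by rewrite -mulrA mulr_natl mulr2n; apply: lerD; apply: h.
Qed.

(** Union bound over the pairs of sizes at distance at most [d = n %/ D]; the second size
    is written [k + j - d] with [j <= 2 d], so that the number of pairs can be read off
    the index type. *)
Lemma indic_near_cuts_le M D n (T1 T2 : tree) : (0 < D)%N -> (0 < n)%N ->
  \1_(near_cuts M D n) (unlabel T1, unlabel T2) <=
  \sum_(p : 'I_n.+1 * 'I_(n %/ D).*2.+1 |
       window M n p.1 && window M n (p.1 + p.2 - n %/ D)%N)
     ncuts p.1 T1 * ncuts (p.1 + p.2 - n %/ D) T2 :> R.
Proof.
move=> D0 n0.
have s0 (p : 'I_n.+1 * 'I_(n %/ D).*2.+1) :
  0 <= ncuts p.1 T1 * ncuts (p.1 + p.2 - n %/ D) T2 by rewrite mulr_ge0.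
rewrite indicE; case: (boolP (_ \in _)) => [|_]; last exact: sumr_ge0.
rewrite inE => -[k1 [k2 /= [w]]]; rewrite !has_cut_repr !has_cut_card => dist c.
have {dist} : (k1 <= k2 + n %/ D)%N && (k2 <= k1 + n %/ D)%N.
  by rewrite -!leq_subLR !leq_divRL // mulnC [((_ - k1) * _)%N]mulnC.
move=> /andP[k12 k21].
have k1n : (k1 < n.+1)%N.
  by case/andP: w => /andP[_]; rewrite ltnS leqNgt; nia.
have jn : (k2 + n %/ D - k1 < (n %/ D).*2.+1)%N by lia.
pose p0 := (Ordinal k1n, Ordinal jn).
have e2 : (k1 + (k2 + n %/ D - k1) - n %/ D = k2)%N by lia.
rewrite (bigD1 p0) /= ?e2 //; apply: ler_wpDr; first exact: sumr_ge0.
by rewrite -natrM ler1n muln_gt0.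
Qed.

(** Independence factorizes the mean of each product of two counts, and each factor
    is O(1/n) for a balanced size. *)
Lemma UA2_near_cuts_le M D n S : (0 < D)%N -> (tree_order S <= n)%N ->
  fine (UA2 R n S (near_cuts M D n)) <=
  (n.+1 * (n %/ D).*2.+1)%:R * (seed_bound S * (2 * (M ^ 2)%:R / n%:R)) ^+ 2.
Proof.
move=> D0 Sn; have n0 : (0 < n)%N by exact: leq_trans Sn.
rewrite UA2_E /=; set k := (n - _)%N.
apply: (@le_trans _ _ (iter k (@step R) (fun T1 => iter k (@step R) (fun T2 =>
  \sum_(p : 'I_n.+1 * 'I_(n %/ D).*2.+1 |
       window M n p.1 && window M n (p.1 + p.2 - n %/ D)%N)
     ncuts p.1 T1 * ncuts (p.1 + p.2 - n %/ D) T2) S) S)).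
  by do 2!(apply: le_iter_step => ? _); exact: indic_near_cuts_le.
rewrite (@eq_iter_step _ _ _ (fun T1 => \sum_(p : 'I_n.+1 * 'I_(n %/ D).*2.+1 |
       window M n p.1 && window M n (p.1 + p.2 - n %/ D)%N)
     iter k (@step R) (ncuts (p.1 + p.2 - n %/ D)) S * ncuts p.1 T1)); last first.
  by move=> T1 _; rewrite iter_step_sum; apply: eq_bigr => p _; rewrite iter_step_scale mulrC.
rewrite iter_step_sum; under eq_bigr do rewrite iter_step_scale.
have bd i : window M n i ->
    0 <= iter k (@step R) (ncuts i) S <= seed_bound S * (2 * (M ^ 2)%:R / n%:R).
  move=> wi; apply/andP; split.
    by rewrite -[leLHS](iter_step_cst k 0 S); apply: le_iter_step.
  apply: le_trans (iter_step_ncuts_le _) _; last first.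
    by rewrite subnKC // ler_wpM2l // profile_window_le.
  by rewrite subnKC //; move/andP: wi; nia.
apply: (@le_trans _ _ (\sum_(p : 'I_n.+1 * 'I_(n %/ D).*2.+1)
    (seed_bound S * (2 * (M ^ 2)%:R / n%:R)) ^+ 2)).
  rewrite [leLHS]big_mkcond; apply: ler_sum => p _; case: ifP => [/andP[w1 w2]|_].
    have /andP[? ?] := bd _ w1; have /andP[? ?] := bd _ w2.
    by rewrite expr2 ler_pM.
  by rewrite exprn_ge0 // mulr_ge0 // divr_ge0 // mulr_ge0.
by rewrite sumr_const card_prod !card_ord -[_ *+ _]mulr_natl.
Qed.

End CutCounts.

(** * The Polya urn followed by a cut *)

Section Urn.
Variable R : realType.
Implicit Types (T S : tree) (g : nat -> nat -> R).

(** The backward operator of the urn with [a] balls of one colour among [t], acting on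
    functions of the time and of the number of balls. *)
Definition urn_step g (t a : nat) : R :=
  a%:R / t%:R * g t.+1 a.+1 + (1 - a%:R / t%:R) * g t.+1 a.

(** Transfer principle: a lower bound on [phi] in terms of the size of an arbitrary cut
    can be averaged along the urn of any cut of the initial tree, because that cut
    survives and its size is the urn. *)
Lemma iter_urn_step_le_step j g (phi : tree -> R) T (A : {set vertex T}) :
  (forall T' (A' : {set vertex T'}), tree_order T' = (tree_order T + j)%N ->
     is_cut A' -> g (tree_order T') #|A'| <= phi T') ->
  is_cut A -> iter j urn_step g (tree_order T) #|A| <= iter j (@step R) phi T.
Proof.
elim: j T A => [|j IH] T A h cA; first by apply: h; rewrite ?addn0.
rewrite -[leRHS]/(_^-1 * \sum_(v : vertex T) iter j (@step R) phi (attach v)).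
rewrite ler_pdivlMl ?tree_order_gt0 //.
apply: (@le_trans _ _ (\sum_(v : vertex T)
    iter j urn_step g (tree_order T).+1 (#|A| + (v \in A))%N)).
  rewrite (bigID (mem A)) /=.
  rewrite (eq_bigr (fun=> iter j urn_step g (tree_order T).+1 #|A|.+1)); last first.
    by move=> v ->; rewrite addn1.
  rewrite [X in _ <= _ + X](eq_bigr (fun=> iter j urn_step g (tree_order T).+1 #|A|)); last first.
    by move=> v /negPf ->; rewrite addn0.
  rewrite !sumr_const.
  have -> : #|[pred i : vertex T | i \notin A]| = (tree_order T - #|A|)%N.
    by rewrite -[tree_order T]card_ord -(cardC A) addKn.
  rewrite -[X in _ <= X + _]mulr_natl -[X in _ <= _ + X]mulr_natl natrB; last by rewrite -[leqRHS]card_ord max_card.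
  rewrite /urn_step; move: (iter _ _ _ _ _) (iter _ _ _ _ _) => x y.
  have t0 : (tree_order T)%:R != 0 :> R by rewrite gt_eqF // tree_order_gt0.
  move: (tree_order T)%:R t0 (#|A|%:R) => t t0 a.
  by rewrite le_eqVlt; apply/orP; left; apply/eqP; field.
apply: ler_sum => v _; rewrite -(card_extend (v \in A) A).
apply: (IH (attach v) (extend (v \in A) A)); last exact: is_cut_extend.
by move=> T' A' e; apply: h; rewrite e addSnnS.
Qed.

Lemma iter_urn_step_affine j c d g t a :
  iter j urn_step (fun n k => c - d * g n k) t a = c - d * iter j urn_step g t a.
Proof.
by elim: j t a => [//|j IH] t a; rewrite !iterS /urn_step !IH; ring.
Qed.

(** The proportion is a martingale whose increment at time [t] has conditional variance
    at most [1 / (t (t + 1)) = 1 / t - 1 / (t + 1)]; the sum telescopes. *)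
Lemma iter_urn_step_variance j x t a : (0 < t)%N ->
  (a <= t)%N ->
  iter j urn_step (fun n k => (k%:R / n%:R - x) ^+ 2) t a <=
  (a%:R / t%:R - x) ^+ 2 + t%:R^-1 - (t + j)%:R^-1.
Proof.
elim: j t a => [|j IH] t a t0 ta; first by rewrite addn0 addrK.
rewrite iterS /urn_step.
have p0 : (0 : R) <= a%:R / t%:R by rewrite divr_ge0.
have p1 : a%:R / t%:R <= (1 : R) by rewrite ler_pdivrMr ?ltr0n // mul1r ler_nat.
apply: (@le_trans _ _ (a%:R / t%:R * ((a.+1%:R / t.+1%:R - x) ^+ 2 + t.+1%:R^-1 - (t + j.+1)%:R^-1)
    + (1 - a%:R / t%:R) * ((a%:R / t.+1%:R - x) ^+ 2 + t.+1%:R^-1 - (t + j.+1)%:R^-1))).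
  apply: lerD; apply: ler_wpM2l; rewrite ?subr_ge0 // -addSnnS; apply: IH => //.
  exact: leqW.
move: ((t + j.+1)%:R^-1) => e.
rewrite -[t.+1%:R]natr1 -[a.+1%:R]natr1.
have t1 : 0 < t%:R :> R by rewrite ltr0n.
move: (t%:R) t1 (a%:R) p0 p1 => r r0 b p0 p1 {IH t0 ta t a}.
have -> : b / r * (((b + 1) / (r + 1) - x) ^+ 2 + (r + 1)^-1 - e) +
  (1 - b / r) * ((b / (r + 1) - x) ^+ 2 + (r + 1)^-1 - e) =
  (b / r - x) ^+ 2 + r^-1 - e -
    (1 - b / r * (1 - b / r) * (r / (r + 1))) / (r * (r + 1)).
  by field; rewrite !gt_eqF //; lra.
rewrite gerBl divr_ge0 //; last by nra.
rewrite subr_ge0 mulr_ile1 //.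
- by rewrite mulr_ge0 ?subr_ge0.
- by rewrite divr_ge0; lra.
- by rewrite mulr_ile1 ?subr_ge0 //; lra.
- by rewrite ler_pdivrMr; lra.
Qed.

(** If every value in [1, n - 1] has probability at most [p] at time [n], then every
    value has probability at most [p (n - k) / n + p (k - 1) / n = p (n - 1) / n] at
    time [n + 1].  Starting from [p = 1] at time [t], these factors telescope. *)
Lemma iter_urn_step_spread j g t a :
  (forall n k, (k <= n)%N -> 0 <= g n k) -> (0 < a < t)%N ->
  iter j urn_step g t a <=
  t.-1%:R / (t + j).-1%:R * \sum_(1 <= k < t + j) g (t + j)%N k.
Proof.
elim: j g => [|j IH] g g0 /andP[a0 at_].
  have t1 : t.-1%:R != 0 :> R by rewrite pnatr_eq0; lia.
  rewrite addn0 divff // mul1r /= (@big_cat_nat _ _ _ a) //=; last exact: ltnW.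
  rewrite (big_ltn at_) /= addrCA ler_wpDr // addr_ge0 // big_nat_cond.
    by rewrite sumr_ge0 // => k /andP[/andP[_ ka] _]; apply: g0; lia.
  by rewrite sumr_ge0 // => k /andP[/andP[_ ka] _]; apply: g0; lia.
rewrite iterSr; apply: le_trans (IH _ _ _) _; last 1 first.
- have : (0 < (t + j).-1)%N by lia.
  rewrite addnS; set n := (t + j)%N => n1.
  have nn : n%:R = n.-1%:R + 1 :> R by rewrite natr1 prednK //; lia.
  have n0 : n%:R != 0 :> R by rewrite pnatr_eq0; lia.
  have n0' : n.-1%:R != 0 :> R by rewrite pnatr_eq0; lia.
  rewrite /urn_step big_split /=.
  have -> : \sum_(1 <= k < n) k%:R / n%:R * g n.+1 k.+1 =
      \sum_(1 <= k < n.+1) k.-1%:R / n%:R * g n.+1 k.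
    have n2 : (1 < n.+1)%N by lia.
    by rewrite [RHS](big_ltn n2) /= !mul0r add0r [RHS]big_add1.
  have -> : \sum_(1 <= k < n) (1 - k%:R / n%:R) * g n.+1 k =
      \sum_(1 <= k < n.+1) (1 - k%:R / n%:R) * g n.+1 k.
    have n2 : (1 <= n)%N by lia.
    by rewrite [RHS](big_nat_recr _ _ _ n2) /= divff // subrr mul0r addr0.
  rewrite -big_split /= le_eqVlt; apply/orP; left; apply/eqP.
  rewrite (eq_big_nat _ _ (F2 := fun k => n.-1%:R / n%:R * g n.+1 k)); last first.
    move=> k /andP[k1 _]; rewrite -mulrDl; congr (_ * _).
    by rewrite -[k in X in _ - X](prednK k1) -natr1 nn; field; rewrite -nn.
  rewrite -mulr_sumr mulrA; congr (_ * _).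
  by field; rewrite n0 n0'.
- move=> n k kn; rewrite /urn_step addr_ge0 // mulr_ge0 ?g0 //; try lia.
  rewrite subr_ge0; case: n kn => [|n] kn; first by rewrite invr0 mulr0.
  by rewrite ler_pdivrMr ?ltr0n // mul1r ler_nat.
- by rewrite a0.
Qed.

(** * Probability of close cuts under the correlated law *)

Definition cut_near (r x : R) (n : nat) : set utree :=
  [set u | exists2 k, has_cut (repr u) k & `|k%:R / n%:R - x| <= r].

(** Chebyshev along the urn of [A], in the pointwise form
    [1 - (2 D y) ^ 2 <= 1_(|y| <= 1 / (2 D))], where [y] is the deviation of the
    proportion from its starting value. *)
Lemma UA_cut_near_ge n T (A : {set vertex T}) (D : nat) : is_cut A ->
  (0 < D)%N -> (tree_order T <= n)%N ->
  1 - 4 * (D ^ 2)%:R / (tree_order T)%:R <=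
  iter (n - tree_order T) (@step R) (fun T' =>
    \1_(cut_near (2 * D%:R)^-1 (#|A|%:R / (tree_order T)%:R) n) (unlabel T')) T.
Proof.
move=> cA D0 Tn; set t := tree_order T; set x := #|A|%:R / t%:R; set j := (n - t)%N.
have d0 : 0 < D%:R :> R by rewrite ltr0n.
pose g n k : R := 1 - (2 * D%:R) ^+ 2 * (k%:R / n%:R - x) ^+ 2.
apply: (@le_trans _ _ (iter j urn_step g t #|A|)).
  rewrite /g iter_urn_step_affine lerD2l lerN2.
  have /andP[_ At] := is_cut_bounds cA.
  have := iter_urn_step_variance j x (ltn0Sn _ : 0 < t)%N (ltnW At).
  rewrite subrr expr0n add0r subnKC // => h.
  rewrite exprMn natrX -mulrA -[2 ^+ 2]natrX.
  have n0 : 0 <= n%:R^-1 :> R by rewrite invr_ge0.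
  have D2 : 0 <= D%:R ^+ 2 :> R by rewrite exprn_ge0.
  have {h} : iter j urn_step (fun n k => (k%:R / n%:R - x) ^+ 2) t #|A| <= t%:R^-1.
    by apply: le_trans h _; rewrite gerBl.
  by move: (iter _ _ _ _ _) (t%:R^-1) => ? ?; nra.
apply: iter_urn_step_le_step => // T' A' e cA'.
rewrite /g indicE e subnKC //.
case: (lerP `|#|A'|%:R / n%:R - x| (2 * D%:R)^-1) => hx.
  rewrite mem_set; last first.
    exists #|A'| => //; rewrite has_cut_repr; apply/existsP; exists A'; by rewrite cA' eqxx.
  by rewrite gerBl mulr_ge0 ?sqr_ge0.
apply: (@le_trans _ _ 0) => //.
rewrite subr_le0 -exprMn -[leLHS](expr1n _ 2) -[leRHS]real_normK ?num_real //.
rewrite lerXn2r ?nnegrE // normrM gtr0_norm ?mulr_gt0 // mulrC.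
by rewrite -ler_pdivrMr ?mulr_gt0 // mul1r ltW.
Qed.

Lemma windowP M n k : (n <= M * k)%N -> (n + M * k <= M * n)%N -> window M n k.
Proof. by move=> wl wu; rewrite /window wl mulnBr; lia. Qed.

(** If [x = a / t] lies in [2 / M, 1 - 2 / M], then a proportion within
    [1 / (2 D) <= 1 / M] of [x] lies in [1 / M, 1 - 1 / M], and two such proportions
    differ by at most [1 / D]. *)
Lemma cut_near_sub (M D n t a : nat) : (0 < n)%N -> (0 < t)%N -> (0 < M)%N -> (M <= 2 * D)%N ->
  (2 * t <= M * a)%N -> (2 * t + M * a <= M * t)%N ->
  let I := cut_near (2 * D%:R)^-1 (a%:R / t%:R) n in I `*` I `<=` near_cuts M D n.
Proof.
move=> n0 t0 M0 MD ta tb I [u1 u2] [/= [k1 c1 h1] [k2 c2 h2]].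
have D0 : (0 < D)%N by lia.
move: h1 h2; set x := a%:R / t%:R; set r := (2 * D%:R)^-1.
have rn : r * (2 * D%:R) = 1 by rewrite mulVf // mulf_neq0 // pnatr_eq0; lia.
have n0' : 0 < n%:R :> R by rewrite ltr0n.
have M0' : 0 < M%:R :> R by rewrite ltr0n.
have D0' : 0 < D%:R :> R by rewrite ltr0n.
have r0 : 0 < r by rewrite invr_gt0 mulr_gt0.
have Mr : M%:R * r <= 1.
  by rewrite -[leRHS]rn mulrC ler_pM2l // -natrM ler_nat.
have xl : 2 <= M%:R * x.
  by rewrite mulrA ler_pdivlMr ?ltr0n // -!natrM ler_nat.
have xu : M%:R * x <= M%:R - 2.
  rewrite lerBrDr mulrA -(ler_pM2r (_ : 0 < t%:R)) ?ltr0n // mulrDl divfK; last first.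
    by rewrite pnatr_eq0; lia.
  by rewrite -!natrM -natrD ler_nat addnC.
clearbody x r.
have key k : `|k%:R / n%:R - x| <= r -> window M n k /\ `|k%:R - x * n%:R| <= r * n%:R.
  move=> hk.
  have h2 : `|k%:R - x * n%:R| <= r * n%:R.
    rewrite -{1}[k%:R](divfK (_ : n%:R != 0)) ?gt_eqF // -mulrBl normrM (gtr0_norm n0').
    by rewrite ler_pM2r.
  split => //; move: h2; rewrite ler_norml => /andP[hl hu].
  have q1 : M%:R * r * n%:R <= n%:R by rewrite ler_piMl.
  have q2 : 2 * n%:R <= M%:R * x * n%:R by rewrite ler_pM2r.
  have q3 : M%:R * x * n%:R <= (M%:R - 2) * n%:R by rewrite ler_pM2r.
  have := ler_wpM2l (ltW M0') hl; have := ler_wpM2l (ltW M0') hu => {}hu {}hl.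
  have wl : n%:R <= M%:R * k%:R :> R by lra.
  have wu : n%:R + M%:R * k%:R <= M%:R * n%:R :> R by lra.
  move: wl wu; rewrite -!natrM -natrD !ler_nat => wl wu.
  exact: windowP.
move=> /key[w1 h1] /key[w2 h2].
exists k1, k2; split; rewrite ?w1 ?w2 ?c1 ?c2 //.
have [h12 h21] : D%:R * k1%:R <= D%:R * k2%:R + n%:R :> R /\
    D%:R * k2%:R <= D%:R * k1%:R + n%:R :> R.
  have Drn : D%:R * (r * n%:R) + D%:R * (r * n%:R) = n%:R.
    have -> : D%:R * (r * n%:R) + D%:R * (r * n%:R) = r * (2 * D%:R) * n%:R by ring.
    by rewrite rn mul1r.
  move: h1 h2; rewrite !ler_norml => /andP[l1 u1'] /andP[l2 u2'].
  have := (ler_wpM2l (ltW D0') l1, ler_wpM2l (ltW D0') u1',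
    ler_wpM2l (ltW D0') l2, ler_wpM2l (ltW D0') u2') => -[[[l1' u1''] l2'] u2''].
  by split; lra.
move: h12 h21; rewrite -!natrM -!natrD !ler_nat => h12 h21.
by rewrite !mulnBr !leq_subLR h12 h21.
Qed.

(** Both independent continuations keep the proportion of the common cut, and the product
    event is contained in [near_cuts] by [cut_near_sub]. *)
Lemma UA2_near_cuts_ge M D n T (A : {set vertex T}) : is_cut A ->
  (0 < M)%N -> (M <= 2 * D)%N -> (tree_order T <= n)%N ->
  (2 * tree_order T <= M * #|A|)%N ->
  (2 * tree_order T + M * #|A| <= M * tree_order T)%N ->
  1 - 8 * (D ^ 2)%:R / (tree_order T)%:R <= fine (UA2 R n T (near_cuts M D n)).
Proof.
move=> cA M0 MD Tn Al Au; have D0 : (0 < D)%N by lia.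
have := UA_cut_near_ge cA D0 Tn; set I := cut_near _ _ _; set k := (n - _)%N.
set p := iter _ _ _ _ => hp.
have p1 : p <= 1.
  rewrite -[leRHS](iter_step_cst k 1 T); apply: le_iter_step => T' _.
  by rewrite indicE lern1 leq_b1.
have h : p * p <= fine (UA2 R n T (near_cuts M D n)).
  rewrite UA2_E /= -/k {1}/p mulrC -iter_step_scale.
  apply: le_iter_step => T1 _; rewrite mulrC -iter_step_scale.
  apply: le_iter_step => T2 _; rewrite !indicE -natrM mulnb ler_nat.
  case: (boolP (_ && _)) => // /andP[/set_mem i1 /set_mem i2].
  have n0 : (0 < n)%N by exact: leq_trans Tn.
  rewrite mem_set //; exact: (cut_near_sub n0 (ltn0Sn _) M0 MD Al Au).
(* Failure probabilities add: p * p >= 1 - 2 * (1 - p). *)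
apply: le_trans h; apply: (@le_trans _ _ (2 * p - 1)); last first.
  by have := sqr_ge0 (p - 1); rewrite expr2; lra.
by move: hp; rewrite -!mulrA; lra.
Qed.

Lemma sum_le_minn m d : (\sum_(1 <= k < m.+1) (k <= d) = minn m d)%N.
Proof.
elim: m => [|m IH]; first by rewrite big_geq // min0n.
by rewrite big_nat_recr //= IH; lia.
Qed.

(** The sizes that are too unbalanced lie within [d = 2 t %/ M] of an end of the
    range. *)
Lemma sum_extreme_le M t : (0 < M)%N -> (0 < t)%N ->
  \sum_(1 <= k < t) (~~ ((2 * t <= M * k) && (2 * t + M * k <= M * t))%N)%:R <=
  4 * t%:R / M%:R :> R.
Proof.
move=> M0; case: t => // t _; set d := (2 * t.+1 %/ M)%N.
have dM : (d * M <= 2 * t.+1)%N by exact: leq_trunc_div.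
rewrite -natr_sum ler_pdivlMr ?ltr0n // -!natrM ler_nat.
suff : (\sum_(1 <= k < t.+1)
    (~~ ((2 * t.+1 <= M * k) && (2 * t.+1 + M * k <= M * t.+1))) <= d + d)%N by nia.
apply: (@leq_trans (\sum_(1 <= k < t.+1) ((k <= d) + (t.+1 - k <= d)))%N).
  rewrite big_nat_cond [leqRHS]big_nat_cond; apply: leq_sum => k /andP[/andP[k1 kt] _].
  rewrite !leq_divRL // -/d.
  case: (boolP (_ && _)) => //=; rewrite negb_and -!ltnNge => /orP[h|h].
    by have -> : (k * M <= 2 * t.+1)%N by lia.
  have -> : ((t.+1 - k) * M <= 2 * t.+1)%N by rewrite mulnBl; lia.
  by rewrite addn1.
rewrite big_split /= leq_add //; first by rewrite sum_le_minn geq_minr.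
rewrite big_nat_rev /= (eq_big_nat _ _ (F2 := fun k => nat_of_bool (k <= d)%N)).
  by rewrite sum_le_minn geq_minr.
by move=> k /andP[k1 kt]; congr (nat_of_bool (_ <= _)%N); lia.
Qed.

(** The urn of the first new vertex starts at [a = 1], [t = |S| + 1].  Starting one step
    after the seed provides a cut even when [S] is a single vertex. *)
Lemma CUA_near_cuts_ge M D n tstar S : (0 < M)%N -> (M <= 2 * D)%N ->
  (tree_order S < tstar)%N -> (tstar <= n)%N ->
  1 - 8 * (D ^ 2)%:R / tstar%:R - 8 * (tree_order S)%:R / M%:R <=
  fine (CUA R n tstar S (near_cuts M D n)).
Proof.
move=> M0 MD St tn; rewrite CUA_E /=.
have -> : (tstar - tree_order S = (tstar - (tree_order S).+1).+1)%N by lia.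
set j := (tstar - _)%N.
rewrite -[leLHS](@iter_step_cst _ 1 _ S) /= /step ler_pM2l ?invr_gt0 ?tree_order_gt0 //.
apply: ler_sum => v _.
pose out n k : R := (~~ ((2 * n <= M * k) && (2 * n + M * k <= M * n))%N)%:R.
pose b : R := 1 - 8 * (D ^ 2)%:R / tstar%:R.
have jt : ((tree_order S).+1 + j = tstar)%N by rewrite subnKC.
have Aone : #|(extend true finset.set0 : {set vertex (attach v)})| = 1%N.
  by rewrite card_extend cards0.
apply: (@le_trans _ _ (iter j urn_step (fun n k => b - 1 * out n k)
  (tree_order (attach v)) #|(extend true finset.set0 : {set vertex (attach v)})|)).
  rewrite iter_urn_step_affine mul1r Aone lerD2l lerN2.
  have out0 n' k : (k <= n')%N -> 0 <= out n' k by [].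
  apply: le_trans (iter_urn_step_spread j out0 _) _ => //.
  rewrite tree_order_attach jt /=.
  apply: le_trans (ler_wpM2l _ (sum_extreme_le M0 _)) _; first by rewrite divr_ge0.
    exact: leq_ltn_trans St.
  have s0 : (0 < tree_order S)%N by [].
  have t1 : 0 < tstar.-1%:R :> R by rewrite ltr0n; lia.
  have M0' : 0 < M%:R :> R by rewrite ltr0n.
  have tE : tstar%:R <= 2 * tstar.-1%:R :> R by rewrite -natrM ler_nat; lia.
  have -> : (tree_order S)%:R / tstar.-1%:R * (4 * tstar%:R / M%:R) =
    4 * (tree_order S)%:R / M%:R * (tstar%:R / tstar.-1%:R) :> R.
    by field; rewrite !gt_eqF.
  have -> : 8 * (tree_order S)%:R / M%:R = 4 * (tree_order S)%:R / M%:R * 2 :> R by ring.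
  by rewrite ler_wpM2l ?divr_ge0 ?mulr_ge0 // ler_pdivrMr.
apply: iter_urn_step_le_step; last exact: is_cut_new.
move=> T' A'; rewrite tree_order_attach jt => e cA'.
rewrite /out e mul1r; case: (boolP (_ && _)) => [/andP[Al Au]|_] /=.
  by rewrite subr0 /b -e; apply: (UA2_near_cuts_ge cA'); rewrite ?e.
apply: (@le_trans _ _ 0); last exact: fine_ge0.
by rewrite /b addrAC subrr add0r oppr_le0 divr_ge0 // mulr_ge0.
Qed.

Lemma TV_CUA_UA2_ge M D n tstar S : (0 < M)%N -> (M <= 2 * D)%N ->
  (tree_order S < tstar)%N -> (tstar <= n)%N ->
  1 - 8 * (D ^ 2)%:R / tstar%:R - 8 * (tree_order S)%:R / M%:R -
    (seed_bound R S * (2 * (M ^ 2)%:R)) ^+ 2 * (4 / D%:R + 2 / n%:R) <=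
  TV (CUA R n tstar S) (UA2 R n S).
Proof.
move=> M0 MD St tn; have D0 : (0 < D)%N by lia.
have n0 : (0 < n)%N by lia.
have := CUA_near_cuts_ge M0 MD St tn.
have Sn : (tree_order S <= n)%N by lia.
have := UA2_near_cuts_le R M D0 Sn.
have := @le_TV R _ _ (CUA R n tstar S) (UA2 R n S) (near_cuts M D n) (measurable_utree2 _).
set K := seed_bound R S * (2 * (M ^ 2)%:R).
have -> : seed_bound R S * (2 * (M ^ 2)%:R / n%:R) = K / n%:R by rewrite mulrA.
have nR : 0 < n%:R :> R by rewrite ltr0n.
have : (n.+1 * (n %/ D).*2.+1)%:R * (K / n%:R) ^+ 2 <= K ^+ 2 * (4 / D%:R + 2 / n%:R).
  rewrite expr_div_n mulrCA ler_wpM2l ?sqr_ge0 // ler_pdivrMr ?exprn_gt0 //.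
  have -> : (4 / D%:R + 2 / n%:R) * n%:R ^+ 2 = 2 * n%:R * (2 * (n%:R / D%:R) + 1) :> R.
    by field; rewrite ?pnatr_eq0 -?lt0n ?n0 ?D0.
  rewrite natrM ler_pM //; first by rewrite -natrM ler_nat; lia.
  rewrite -addn1 natrD lerD2r -muln2 natrM mulrC ler_wpM2l //.
  by rewrite ler_pdivlMr ?ltr0n // -natrM ler_nat leq_trunc_div.
move=> h1 h2 h3 h4; have := ler_norm (fine (CUA R n tstar S (near_cuts M D n)) -
  fine (UA2 R n S (near_cuts M D n))); lra.
Qed.

Lemma exists_nat_ge (x : R) : exists2 m : nat, (0 < m)%N & x <= m%:R.
Proof. by exists (Num.trunc x).+1 => //; apply/ltW/truncnS_gt. Qed.

End Urn.

(** * The limit *)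

Theorem theorem1p8 (R : realType) (S : tree) :
  (forall tstar : nat, (tree_order S <= tstar)%N ->
     cvg (TV (CUA R n tstar S) (UA2 R n S) @[n --> \oo])) /\
  lim (TV (CUA R n tstar S) (UA2 R n S) @[n --> \oo]) @[tstar --> \oo] --> (1 : R).
Proof.
split; first by move=> tstar; exact: is_cvg_TV_CUA_UA2.
apply/cvgrPdist_le => e e0.
(* Each of the four error terms of [TV_CUA_UA2_ge] is made at most e / 4. *)
have [M M0 hM] := exists_nat_ge (32 * (tree_order S)%:R / e).
set K := (seed_bound R S * (2 * (M ^ 2)%:R)) ^+ 2.
have K0 : 0 <= K by exact: sqr_ge0.
have [D' D'0 hD] := exists_nat_ge (16 * K / e).
pose D := (D' + M)%N.
have [t1 t10 ht] := exists_nat_ge (32 * (D ^ 2)%:R / e).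
have [n1 n10 hn] := exists_nat_ge (8 * K / e).
have quarter c (m : nat) : (0 < m)%N -> 4 * c / e <= m%:R -> c / m%:R <= e / 4.
  move=> m0; rewrite !ler_pdivrMr ?ltr0n //; lra.
exists (maxn t1 (tree_order S).+1) => // tstar /=.
rewrite geq_max => /andP[tt1 tS].
have c := @is_cvg_TV_CUA_UA2 R tstar S (ltnW tS).
set L := lim _.
have L1 : L <= 1 by apply: limr_le => //; apply: nearW => n; exact: TV_le1.
have Le : 1 - e <= L.
  apply: limr_ge => //; exists (maxn n1 tstar) => // n /=.
  rewrite geq_max => /andP[nn1 tn].
  have MD : (M <= 2 * D)%N by rewrite /D; lia.
  apply: le_trans (TV_CUA_UA2_ge R M0 MD tS tn).
  rewrite -/K.
  have q1 : 8 * (D ^ 2)%:R / tstar%:R <= e / 4.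
    apply: quarter; first exact: leq_trans tt1.
    by apply: (@le_trans _ _ t1%:R); rewrite ?ler_nat // mulrA -natrM.
  have q2 : 8 * (tree_order S)%:R / M%:R <= e / 4.
    by apply: quarter; rewrite // mulrA -natrM.
  have q3 : 4 * K / D%:R <= e / 4.
    apply: quarter; first by rewrite addn_gt0 D'0.
    by apply: (@le_trans _ _ D'%:R); rewrite ?ler_nat ?leq_addr // mulrA -natrM.
  have q4 : 2 * K / n%:R <= e / 4.
    apply: quarter; first exact: leq_trans nn1.
    by apply: (@le_trans _ _ n1%:R); rewrite ?ler_nat // mulrA -natrM.
  lra.
by rewrite ler_norml; lra.
Qed.
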